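(* Let $\mathbf{C^k}$ be the free intermuting category generated by a set of objects (letters). Then $\mathbf{C^k}$ is a preorder, i.e. for all objects $A,B$ of $\mathbf{C^k}$ there is at most one arrow of type $A\to B$.
   Context: A biendofunctor of a category $\mathcal A$ is a functor $\mathcal A\times\mathcal A\to\mathcal A$. An intermuting category is a triple $\langle\mathcal A,\wedge,\vee\rangle$ where $\wedge$ and $\vee$ are biendofunctors of the category $\mathcal A$ and there is a natural transformation $c^k$ (intermutation, not assumed to be an isomorphism) with components $$c^k_{A,B,C,D}:(A\wedge B)\vee(C\wedge D)\to(A\vee C)\wedge(B\vee D).$$ No other equations are assumed. The free intermuting category $\mathbf{C^k}$ generated by a set of letters: objects are the formulae, built from letters by the binary connectives $\wedge$ and $\vee$. Arrow terms are typed expressions generated from $\mathbf 1_A:A\to A$ and $c^k_{A,B,C,D}$ (for all formulae $A,B,C,D$) by composition $\circ$ (when types match) and by the operations $\wedge,\vee$ (from $f:A\to B$, $g:C\to D$ one forms $f\,\xi\, g:A\,\xi\, C\to B\,\xi\, D$ for $\xi\in\{\wedge,\vee\}$). Arrows are equivalence classes of arrow terms under the smallest equivalence relation, congruent with respect to $\circ,\wedge,\vee$, containing the category equations, the functoriality equations for $\wedge$ and $\vee$, and the naturality equations for $c^k$. *)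

(* Defs.v *)
From Stdlib Require Import FunctionalExtensionality PropExtensionality.

Set Implicit Arguments.
Unset Strict Implicit.

(** * Intermuting categories *)

Record category : Type := Category {
  obj : Type;
  hom : obj -> obj -> Type;
  idt : forall A, hom A A;
  comp : forall A B C, hom B C -> hom A B -> hom A C;
  comp_idl : forall A B (f : hom A B), comp (idt B) f = f;
  comp_idr : forall A B (f : hom A B), comp f (idt A) = f;
  comp_assoc : forall A B C D (h : hom C D) (g : hom B C) (f : hom A B),
    comp h (comp g f) = comp (comp h g) f
}.

Arguments hom {c} A B.
Arguments idt {c} A.
Arguments comp {c A B C} g f.

(** A functor from the product category [C * C] to [C], in curried form. *)
Record biendofunctor (C : category) : Type := Biendofunctor {
  bobj :> obj C -> obj C -> obj C;
  bmap : forall A B A' B',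
    hom A B -> hom A' B' -> hom (bobj A A') (bobj B B');
  bmap_id : forall A A', bmap (idt A) (idt A') = idt (bobj A A');
  bmap_comp : forall A B D A' B' D' (g : hom B D) (f : hom A B)
      (g' : hom B' D') (f' : hom A' B'),
    bmap (comp g f) (comp g' f') = comp (bmap g g') (bmap f f')
}.

Arguments bmap {C} b {A B A' B'} f g.

Record intermuting_category : Type := IntermutingCategory {
  icat :> category;
  wedge : biendofunctor icat;
  vee : biendofunctor icat;
  ck : forall A B C D : obj icat,
    hom (vee (wedge A B) (wedge C D)) (wedge (vee A C) (vee B D));
  ck_natural : forall (A B C D A' B' C' D' : obj icat)
      (f : hom A A') (g : hom B B') (h : hom C C') (k : hom D D'),
    comp (ck A' B' C' D') (bmap vee (bmap wedge f g) (bmap wedge h k))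
    = comp (bmap wedge (bmap vee f h) (bmap vee g k)) (ck A B C D)
}.

Definition is_preorder (C : category) : Prop :=
  forall (A B : obj C) (f g : hom A B), f = g.

(** * Formulae and arrow terms *)

Inductive connective : Type := And | Or.

Inductive formula (L : Type) : Type :=
| Letter (p : L)
| Bin (xi : connective) (A B : formula L).

Inductive term (L : Type) : formula L -> formula L -> Type :=
| Tid A : term A A
| Tck A B C D :
    term (Bin Or (Bin And A B) (Bin And C D))
         (Bin And (Bin Or A C) (Bin Or B D))
| Tcomp A B C : term B C -> term A B -> term A C
| Tbin xi A B C D :
    term A B -> term C D -> term (Bin xi A C) (Bin xi B D).

Arguments Tid {L} A.
Arguments Tck {L} A B C D.
Arguments Tcomp {L A B C} g f.
Arguments Tbin {L} xi {A B C D} f g.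

Inductive term_eq (L : Type) :
  forall A B : formula L, term A B -> term A B -> Prop :=
(* equivalence relation *)
| Erefl A B (f : term A B) : term_eq f f
| Esym A B (f g : term A B) : term_eq f g -> term_eq g f
| Etrans A B (f g h : term A B) : term_eq f g -> term_eq g h -> term_eq f h
(* congruence *)
| Econg_comp A B C (g g' : term B C) (f f' : term A B) :
    term_eq g g' -> term_eq f f' -> term_eq (Tcomp g f) (Tcomp g' f')
| Econg_bin xi A B C D (f f' : term A B) (g g' : term C D) :
    term_eq f f' -> term_eq g g' -> term_eq (Tbin xi f g) (Tbin xi f' g')
(* category equations *)
| Eidl A B (f : term A B) : term_eq (Tcomp (Tid B) f) f
| Eidr A B (f : term A B) : term_eq (Tcomp f (Tid A)) f
| Eassoc A B C D (h : term C D) (g : term B C) (f : term A B) :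
    term_eq (Tcomp h (Tcomp g f)) (Tcomp (Tcomp h g) f)
(* functoriality of the connectives *)
| Ebin_id xi A B : term_eq (Tbin xi (Tid A) (Tid B)) (Tid (Bin xi A B))
| Ebin_comp xi A B C A' B' C' (g : term B C) (f : term A B)
    (g' : term B' C') (f' : term A' B') :
    term_eq (Tbin xi (Tcomp g f) (Tcomp g' f'))
            (Tcomp (Tbin xi g g') (Tbin xi f f'))
(* naturality of intermutation *)
| Eck_natural A B C D A' B' C' D' (f : term A A') (g : term B B')
    (h : term C C') (k : term D D') :
    term_eq
      (Tcomp (Tck A' B' C' D') (Tbin Or (Tbin And f g) (Tbin And h k)))
      (Tcomp (Tbin And (Tbin Or f h) (Tbin Or g k)) (Tck A B C D)).

(** * Arrows: equivalence classes of arrow terms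

    A class is the set of terms equal to one of its members, so that equality
    of arrows is Leibniz equality. *)

Definition arrow (L : Type) (A B : formula L) : Type :=
  {X : term A B -> Prop | exists f, X = term_eq f}.

Definition class (L : Type) (A B : formula L) (f : term A B) : arrow A B :=
  exist _ (term_eq f) (ex_intro _ f eq_refl).

Lemma class_eqP (L : Type) (A B : formula L) (f g : term A B) :
  class f = class g <-> term_eq f g.
Proof.
split.
- intros E. apply (f_equal (@proj1_sig _ _)) in E; simpl in E.
  rewrite E. apply Erefl.
- intros E. assert (H : term_eq f = term_eq g).
  { extensionality h. apply propositional_extensionality; split; intros H.
    - exact (Etrans (Esym E) H).
    - exact (Etrans E H). }
  unfold class. apply eq_sig_hprop; [|exact H].
  intros; apply proof_irrelevance.
Qed.

Lemma class_surj (L : Type) (A B : formula L) (x : arrow A B) :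
  exists f, x = class f.
Proof. destruct x as [X [f ->]]. exists f. reflexivity. Qed.

(** The operations on arrows are those on arrow terms, applied to all
    representatives. *)

Lemma acomp_subproof (L : Type) (A B C : formula L)
    (y : arrow B C) (x : arrow A B) :
  exists t, (fun h => exists g f,
    proj1_sig y g /\ proj1_sig x f /\ term_eq (Tcomp g f) h) = term_eq t.
Proof.
destruct y as [Y [g ->]], x as [X [f ->]]; simpl.
exists (Tcomp g f). extensionality h.
apply propositional_extensionality; split.
- intros (g' & f' & Hg & Hf & H). exact (Etrans (Econg_comp Hg Hf) H).
- intros H. exists g, f. repeat split; trivial; apply Erefl.
Qed.

Definition acomp (L : Type) (A B C : formula L)
    (y : arrow B C) (x : arrow A B) : arrow A C :=
  exist _ _ (acomp_subproof y x).

Lemma abin_subproof (L : Type) (xi : connective) (A B C D : formula L)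
    (x : arrow A B) (y : arrow C D) :
  exists t, (fun h => exists f g,
    proj1_sig x f /\ proj1_sig y g /\ term_eq (Tbin xi f g) h) = term_eq t.
Proof.
destruct y as [Y [g ->]], x as [X [f ->]]; simpl.
exists (Tbin xi f g). extensionality h.
apply propositional_extensionality; split.
- intros (f' & g' & Hf & Hg & H). exact (Etrans (Econg_bin xi Hf Hg) H).
- intros H. exists f, g. repeat split; trivial; apply Erefl.
Qed.

Definition abin (L : Type) (xi : connective) (A B C D : formula L)
    (x : arrow A B) (y : arrow C D) : arrow (Bin xi A C) (Bin xi B D) :=
  exist _ _ (abin_subproof xi x y).

Lemma acomp_class (L : Type) (A B C : formula L)
    (g : term B C) (f : term A B) :
  acomp (class g) (class f) = class (Tcomp g f).
Proof.
destruct (class_surj (acomp (class g) (class f))) as [t E]; rewrite E.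
apply class_eqP.
apply (f_equal (@proj1_sig _ _)) in E; simpl in E.
rewrite <- E. exists g, f. repeat split; apply Erefl.
Qed.

Lemma abin_class (L : Type) (xi : connective) (A B C D : formula L)
    (f : term A B) (g : term C D) :
  abin xi (class f) (class g) = class (Tbin xi f g).
Proof.
destruct (class_surj (abin xi (class f) (class g))) as [t E]; rewrite E.
apply class_eqP.
apply (f_equal (@proj1_sig _ _)) in E; simpl in E.
rewrite <- E. exists f, g. repeat split; apply Erefl.
Qed.

(** * The free intermuting category *)

Ltac on_representatives :=
  repeat match goal with
  | x : arrow _ _ |- _ =>
      let f := fresh "f" in destruct (class_surj x) as [f ->]
  end;
  repeat (rewrite acomp_class || rewrite abin_class); apply class_eqP.

Lemma acomp_idl (L : Type) (A B : formula L) (x : arrow A B) :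
  acomp (class (Tid B)) x = x.
Proof. on_representatives. apply Eidl. Qed.

Lemma acomp_idr (L : Type) (A B : formula L) (x : arrow A B) :
  acomp x (class (Tid A)) = x.
Proof. on_representatives. apply Eidr. Qed.

Lemma acomp_assoc (L : Type) (A B C D : formula L)
    (z : arrow C D) (y : arrow B C) (x : arrow A B) :
  acomp z (acomp y x) = acomp (acomp z y) x.
Proof. on_representatives. apply Eassoc. Qed.

Definition Ck_category (L : Type) : category :=
  Category (@acomp_idl L) (@acomp_idr L) (@acomp_assoc L).

Lemma abin_id (L : Type) (xi : connective) (A B : formula L) :
  abin xi (class (Tid A)) (class (Tid B)) = class (Tid (Bin xi A B)).
Proof. on_representatives. apply Ebin_id. Qed.

Lemma abin_comp (L : Type) (xi : connective) (A B C A' B' C' : formula L)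
    (y : arrow B C) (x : arrow A B) (y' : arrow B' C') (x' : arrow A' B') :
  abin xi (acomp y x) (acomp y' x') = acomp (abin xi y y') (abin xi x x').
Proof. on_representatives. apply Ebin_comp. Qed.

Definition Ck_bin (L : Type) (xi : connective) :
    biendofunctor (Ck_category L) :=
  @Biendofunctor (Ck_category L) (Bin xi) (@abin L xi)
    (@abin_id L xi) (@abin_comp L xi).

Lemma ack_natural (L : Type) (A B C D A' B' C' D' : formula L)
    (x : arrow A A') (y : arrow B B') (z : arrow C C') (t : arrow D D') :
  acomp (class (Tck A' B' C' D')) (abin Or (abin And x y) (abin And z t))
  = acomp (abin And (abin Or x z) (abin Or y t)) (class (Tck A B C D)).
Proof. on_representatives. apply Eck_natural. Qed.

Definition Ck (L : Type) : intermuting_category :=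
  @IntermutingCategory (Ck_category L) (Ck_bin L And) (Ck_bin L Or)
    (fun A B C D => class (Tck A B C D)) (@ack_natural L).

(* Main.v *)
From Stdlib Require Import ProofIrrelevance.
Require Import Defs.

Set Implicit Arguments.
Unset Strict Implicit.

(** The path from the root to a leaf yields a word of left/right choices at
    [And]-nodes and another at [Or]-nodes; intermutation only changes how the
    two words are interleaved. Hence the source [A] of an arrow into
    [B1 And B2] meets an [And] on every branch, and cutting [A] at the topmost
    ones gives a canonical arrow [A -> lpart A And rpart A]. These arrows are
    natural in [A], so every arrow [A -> B1 And B2] is the canonical one
    followed by a conjunction of arrows. An arrow into a disjunction is a
    disjunction of arrows, and an arrow into a letter is an identity;
    uniqueness follows by induction on the target. *)

Section Coherence.

Variable L : Type.
Implicit Types A B C D : formula L.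

Fixpoint splittable A : Prop :=
  match A with
  | Letter _ => False
  | Bin And _ _ => True
  | Bin Or B C => splittable B /\ splittable C
  end.

(* The value on letters is junk: letters are not splittable. *)
Fixpoint lpart A : formula L :=
  match A with
  | Letter p => Letter p
  | Bin And B _ => B
  | Bin Or B C => Bin Or (lpart B) (lpart C)
  end.

Fixpoint rpart A : formula L :=
  match A with
  | Letter p => Letter p
  | Bin And _ C => C
  | Bin Or B C => Bin Or (rpart B) (rpart C)
  end.

Fixpoint split A : splittable A -> term A (Bin And (lpart A) (rpart A)) :=
  match A with
  | Letter _ => fun s => False_rect _ s
  | Bin And B C => fun _ => Tid (Bin And B C)
  | Bin Or B C => fun s =>
      Tcomp (Tck (lpart B) (rpart B) (lpart C) (rpart C))
            (Tbin Or (split (proj1 s)) (split (proj2 s)))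
  end.

Lemma splittable_iff A B (f : term A B) : splittable A <-> splittable B.
Proof.
induction f as [| | |[|]]; simpl; tauto.
Qed.

(** [split] at a disjunction is [Tck] after two smaller splits, so the case of [Tbin Or] reduces to
    [Eck_natural]. *)
Lemma split_natural A B (f : term A B) (a : splittable A) (b : splittable B) :
  exists (l : term (lpart A) (lpart B)) (r : term (rpart A) (rpart B)),
    term_eq (Tcomp (split b) f) (Tcomp (Tbin And l r) (split a)).
Proof.
induction f as [A|A B C D|A B C g IHg f IHf|[|] A B C D f IHf g IHg].
- exists (Tid _), (Tid _).
  rewrite (proof_irrelevance _ b a).
  apply (Etrans (Eidr _)), Esym.
  apply (Etrans (Econg_comp (Ebin_id _ _ _) (Erefl _))), Eidl.
(* Both ends of [Tck] have the same [lpart] and [rpart], and [split] of its source is [Tck] after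
   identities. *)
- exists (Tid _), (Tid _); simpl.
  apply (Etrans (Eidl _)), Esym.
  apply (Etrans (Econg_comp (Ebin_id _ _ _) (Erefl _))).
  apply (Etrans (Eidl _)).
  apply (Etrans (Econg_comp (Erefl _) (Ebin_id _ _ _))), Eidr.
- pose proof (proj1 (splittable_iff f) a) as m.
  destruct (IHg m b) as (lg & rg & Eg), (IHf a m) as (lf & rf & Ef).
  exists (Tcomp lg lf), (Tcomp rg rf).
  apply (Etrans (Eassoc _ _ _)).
  apply (Etrans (Econg_comp Eg (Erefl _))).
  apply (Etrans (Esym (Eassoc _ _ _))).
  apply (Etrans (Econg_comp (Erefl _) Ef)).
  apply (Etrans (Eassoc _ _ _)).
  exact (Econg_comp (Esym (Ebin_comp _ _ _ _ _)) (Erefl _)).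
- exists f, g; simpl.
  exact (Etrans (Eidl _) (Esym (Eidr _))).
- destruct (IHf (proj1 a) (proj1 b)) as (lf & rf & Ef),
    (IHg (proj2 a) (proj2 b)) as (lg & rg & Eg).
  exists (Tbin Or lf lg), (Tbin Or rf rg); simpl.
  apply (Etrans (Esym (Eassoc _ _ _))).
  apply (Etrans (Econg_comp (Erefl _) (Esym (Ebin_comp _ _ _ _ _)))).
  apply (Etrans (Econg_comp (Erefl _) (Econg_bin _ Ef Eg))).
  apply (Etrans (Econg_comp (Erefl _) (Ebin_comp _ _ _ _ _))).
  apply (Etrans (Eassoc _ _ _)).
  apply (Etrans (Econg_comp (Eck_natural _ _ _ _) (Erefl _))).
  exact (Esym (Eassoc _ _ _)).
Qed.

Lemma term_to_And A B C (f : term A (Bin And B C)) (a : splittable A) :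
  exists (l : term (lpart A) B) (r : term (rpart A) C),
    term_eq f (Tcomp (Tbin And l r) (split a)).
Proof.
(* [split] at the conjunction [Bin And B C] is [Tid]. *)
destruct (@split_natural _ (Bin And B C) f a I) as (l & r & E).
exists l, r.
exact (Etrans (Esym (Eidl _)) E).
Qed.

(* Matching on both types at once makes the shape of the source part of the
   conclusion: a term into a letter or a disjunction from a source of another
   shape would prove [False]. *)
Definition rigid A B : term A B -> Prop :=
  match A, B return term A B -> Prop with
  | _, Bin And _ _ => fun _ => True
  | Letter p, Letter q => fun f =>
      exists e : p = q,
        term_eq f (eq_rect p (fun q => term (Letter p) (Letter q)) (Tid _) q e)
  | Bin Or A1 A2, Bin Or B1 B2 => fun f =>
      exists (f1 : term A1 B1) (f2 : term A2 B2), term_eq f (Tbin Or f1 f2)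
  | _, _ => fun _ => False
  end.

Lemma term_rigid A B (f : term A B) : rigid f.
Proof.
induction f as [A|A B C D|A B C g IHg f IHf|[|] A B C D f IHf g IHg].
- destruct A as [p|[|] A1 A2]; simpl.
  + exists eq_refl; apply Erefl.
  + exact I.
  + exists (Tid _), (Tid _); exact (Esym (Ebin_id _ _ _)).
- exact I.
(* Unless [C] is a conjunction, [A] and [B] share its shape: a mismatch makes [IHf] or [IHg]
   false. *)
- destruct C as [r|[|] C1 C2]; [|now destruct A as [?|[|] ? ?]|];
    destruct B as [q|[|] B1 B2]; try easy;
    destruct A as [p|[|] A1 A2]; try easy; simpl in *.
  + destruct IHg as [e Eg], IHf as [e' Ef].
    destruct e, e'; exists eq_refl; simpl in *.
    exact (Etrans (Econg_comp Eg Ef) (Eidl _)).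
  + destruct IHg as (g1 & g2 & Eg), IHf as (f1 & f2 & Ef).
    exists (Tcomp g1 f1), (Tcomp g2 f2).
    exact (Etrans (Econg_comp Eg Ef) (Esym (Ebin_comp _ _ _ _ _))).
- exact I.
- exists f, g; apply Erefl.
Qed.

Lemma term_eq_total A B (f g : term A B) : term_eq f g.
Proof.
revert A f g; induction B as [q|[|] B1 IH1 B2 IH2]; intros A f g.
- pose proof (term_rigid f) as Rf; pose proof (term_rigid g) as Rg.
  destruct A as [p|[|] A1 A2]; try easy.
  destruct Rf as [e Ef], Rg as [e' Eg].
  (* Now [f] and [g] equal the same transported identity. *)
  rewrite (proof_irrelevance _ e' e) in Eg.
  exact (Etrans Ef (Esym Eg)).
- pose proof (proj2 (splittable_iff f) I) as a.
  destruct (term_to_And f a) as (lf & rf & Ef).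
  destruct (term_to_And g a) as (lg & rg & Eg).
  apply (Etrans Ef), Esym, (Etrans Eg).
  exact (Econg_comp (Econg_bin _ (IH1 _ _ _) (IH2 _ _ _)) (Erefl _)).
- pose proof (term_rigid f) as Rf; pose proof (term_rigid g) as Rg.
  destruct A as [p|[|] A1 A2]; try easy.
  destruct Rf as (f1 & f2 & Ef), Rg as (g1 & g2 & Eg).
  apply (Etrans Ef), Esym, (Etrans Eg).
  exact (Econg_bin _ (IH1 _ _ _) (IH2 _ _ _)).
Qed.

End Coherence.

Theorem mainTheorem1 (L : Type) : is_preorder (Ck L).
Proof.
intros A B f g.
destruct (class_surj f) as [f' ->], (class_surj g) as [g' ->].
apply class_eqP, term_eq_total.
Qed.
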